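(* For all $x,y\in\mathbb{H}^n$, $$\tilde c_{\mathbb{H}^n}(x,y)=\begin{cases}\dfrac{|x-y|}{\max\{x_n,y_n\}} & \text{if } |x-y|\le\sqrt{(x_n-y_n)^2+|x_n^2-y_n^2|},\\[2ex] 2\sqrt{\dfrac{|x-y|^2-(x_n-y_n)^2}{|x-y|^2+4x_ny_n}} & \text{otherwise.}\end{cases}$$
   Context: For $x\in\mathbb{R}^n$, $x_j$ denotes its $j$th coordinate, $|\cdot|$ is the Euclidean norm, and $\mathbb{H}^n=\{x\in\mathbb{R}^n: x_n>0\}$ is the upper half-space, with boundary $\partial\mathbb{H}^n=\{z\in\mathbb{R}^n:z_n=0\}$. For a domain $G\subsetneq\mathbb{R}^n$ and $x,y\in G$, $$\tilde c_G(x,y)=\frac{|x-y|}{\inf_{z\in\partial G}\max\{|x-z|,|y-z|\}}.$$ *)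

(* Defs.v *)
From HB Require Import structures.
From mathcomp Require Import all_boot all_order all_algebra.
From mathcomp Require Import all_classical all_reals all_analysis.
Set Implicit Arguments.
Unset Strict Implicit.
Unset Printing Implicit Defensive.
Import Order.TTheory GRing.Theory Num.Theory.
Import numFieldNormedType.Exports.
Local Open Scope classical_set_scope.
Local Open Scope ring_scope.

(* The library norm on 'rV[R]_n is the sup norm, which induces the same
   topology; only the topology of 'rV[R]_n is used below, in [boundary]. *)
Definition enorm (R : realType) (n : nat) (x : 'rV[R]_n) : R :=
  Num.sqrt (\sum_(i < n) x ord0 i ^+ 2).

Definition boundary (T : topologicalType) (A : set T) : set T :=
  closure A `\` interior A.

(* The real-valued [inf] is the true infimum here as soon as [boundary G] is
   nonempty, e.g. for every nonempty proper subset [G] of R^n. *)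
Definition tilde_c (R : realType) (n : nat) (G : set 'rV[R]_n)
    (x y : 'rV[R]_n) : R :=
  enorm (x - y) /
  inf [set Num.max (enorm (x - z)) (enorm (y - z)) | z in boundary G].

(* R^n is ['rV[R]_m.+1] with n = m + 1 >= 1, so that the last coordinate x_n
   is the entry at [ord_max]. *)
Definition lastc (R : realType) (m : nat) (x : 'rV[R]_m.+1) : R :=
  x ord0 ord_max.

Definition upper_half_space (R : realType) (m : nat) : set 'rV[R]_m.+1 :=
  [set x | 0 < lastc x].
Arguments upper_half_space : clear implicits.

(* Main.v *)
Require Import Defs.
From mathcomp Require Import all_boot all_order all_algebra.
From mathcomp Require Import all_classical all_reals all_analysis.
From mathcomp Require Import ring lra.
Import Order.TTheory GRing.Theory Num.Theory.
Import numFieldNormedType.Exports.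
Local Open Scope classical_set_scope.
Local Open Scope ring_scope.

(** For a boundary point [z] and [0 <= t <= 1], put [w = (1 - t) x + t y].
    Stewart's identity
    [(1 - t) |x - z|^2 + t |y - z|^2 = |w - z|^2 + t (1 - t) |x - y|^2]
    and [|w - z| >= w_n] bound [max{|x - z|, |y - z|}^2] from below by
    [M = w_n^2 + t (1 - t) |x - y|^2].  The bound is attained at the orthogonal
    projection of [w] to the boundary as soon as this point is within
    distance [sqrt M] of both [x] and [y].  When [x_n >= y_n], the first case
    of the formula is [t = 0], and in the second case [t] is chosen so that the
    projection is equidistant from [x] and [y]. *)

Section Enorm.
Set Implicit Arguments.
Unset Strict Implicit.
Variables (R : realType) (n : nat).
Implicit Types (x y z : 'rV[R]_n) (t : R).

Lemma enorm_ge0 x : 0 <= enorm x.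
Proof. exact: sqrtr_ge0. Qed.

Lemma enorm_sqr x : enorm x ^+ 2 = \sum_(i < n) x ord0 i ^+ 2.
Proof. by rewrite sqr_sqrtr // sumr_ge0 // => i _; exact: sqr_ge0. Qed.

Lemma enormB x y : enorm (x - y) = enorm (y - x).
Proof.
by congr Num.sqrt; apply: eq_bigr => i _; rewrite !mxE -sqrrN opprB.
Qed.

Lemma stewart x y z t :
  (1 - t) * enorm (x - z) ^+ 2 + t * enorm (y - z) ^+ 2 =
  enorm ((1 - t) *: x + t *: y - z) ^+ 2 + t * (1 - t) * enorm (x - y) ^+ 2.
Proof.
rewrite !enorm_sqr !mulr_sumr -!big_split /=; apply: eq_bigr => i _.
by rewrite !mxE; ring.
Qed.

End Enorm.

Section HalfSpace.
Set Implicit Arguments.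
Unset Strict Implicit.
Variables (R : realType) (m : nat).
Implicit Types (x y z : 'rV[R]_m.+1) (t : R).

Lemma lastc_sqr_le x : lastc x ^+ 2 <= enorm x ^+ 2.
Proof.
rewrite enorm_sqr (bigD1 ord_max) //= lerDl sumr_ge0 // => i _.
exact: sqr_ge0.
Qed.

Lemma lastcB x y : lastc (x - y) = lastc x - lastc y.
Proof. by rewrite /lastc !mxE. Qed.

Lemma lastc_continuous : continuous (@lastc R m).
Proof. by move=> x; exact: coord_continuous. Qed.

(** The half-space is open, so it is its own interior, and its closure stays in the closed set
    [0 <= lastc z]. Conversely, every point of height 0 is a limit of points just above it. *)
Lemma boundary_upper_half_space :
  boundary (upper_half_space R m) = [set z | lastc z = 0].
Proof.
have oH : open (upper_half_space R m).
  rewrite (_ : upper_half_space R m = @lastc R m @^-1` [set r | 0 < r]) //.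
  by apply: open_comp => [? _|]; [exact: lastc_continuous|exact: open_gt].
have cH : closed [set z | 0 <= @lastc R m z].
  rewrite (_ : mkset _ = @lastc R m @^-1` [set r | 0 <= r]) //.
  by apply: preimage_closed => [|]; [move=> ? ?; exact: lastc_continuous|exact: closed_ge].
rewrite /boundary ((interior_id _).1 oH); apply/seteqP; split => z /=.
  move=> [cz nz]; apply/eqP; rewrite eq_le leNgt; apply/andP; split.
    exact/negP.
  have HS : upper_half_space R m `<=` [set z | 0 <= lastc z] by move=> u /ltW.
  exact: (cH _ (closureS HS cz)).
move=> z0; split; last by rewrite /upper_half_space /= z0 ltxx.
move=> B /nbhs_ballP[e /= e0 zB].
(* Balls here are sup-norm balls, so raising only the last coordinate by [e / 2] stays inside. *)
exists (z + (e / 2) *: delta_mx ord0 ord_max); split.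
  rewrite /upper_half_space /lastc /= !mxE !eqxx mulr1.
  by rewrite [z _ _]z0 add0r divr_gt0.
apply: zB; split=> // i j; rewrite /ball /= !mxE opprD addrA subrr sub0r normrN.
rewrite normrM ger0_norm; last by rewrite divr_ge0 // ltW.
by case: (_ && _); rewrite ?normr1 ?normr0 ?mulr1 ?mulr0 //; lra.
Qed.

Definition proj0 x : 'rV[R]_m.+1 := x - lastc x *: delta_mx ord0 ord_max.

Lemma lastc_proj0 x : lastc (proj0 x) = 0.
Proof. by rewrite /proj0 /lastc !mxE !eqxx mulr1 subrr. Qed.

(** Pythagoras: the horizontal part of [x - w] is [t (x - y)], and the vertical part is all of
    [lastc x] because the projection has height 0. *)
Lemma enorm_sub_proj0 x y t :
  enorm (x - proj0 ((1 - t) *: x + t *: y)) ^+ 2 =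
  t ^+ 2 * (enorm (x - y) ^+ 2 - (lastc x - lastc y) ^+ 2) + lastc x ^+ 2.
Proof.
rewrite !enorm_sqr (bigD1 ord_max) //= [in RHS](bigD1 ord_max) //=.
set w := (1 - t) *: x + t *: y.
have -> : (x - proj0 w) ord0 ord_max = lastc x.
  by rewrite -[LHS]/(lastc _) lastcB lastc_proj0 subr0.
rewrite -[(x - y) _ _]/(lastc _) lastcB addrC [in RHS]addrAC subrr add0r mulr_sumr.
congr (_ + _); apply: eq_bigr => i /negPf ni.
by rewrite !mxE ni andbF mulr0; ring.
Qed.

(** Upper bounds on the two distances suffice, since Stewart's identity already makes [M] a lower
    bound; thus one lemma serves both cases of the formula. *)
Lemma inf_max_enorm x y t M : 0 <= t <= 1 -> 0 <= M ->
  M ^+ 2 = ((1 - t) * lastc x + t * lastc y) ^+ 2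
           + t * (1 - t) * enorm (x - y) ^+ 2 ->
  enorm (x - proj0 ((1 - t) *: x + t *: y)) <= M ->
  enorm (y - proj0 ((1 - t) *: x + t *: y)) <= M ->
  inf [set Num.max (enorm (x - z)) (enorm (y - z))
      | z in boundary (upper_half_space R m)] = M.
Proof.
move=> /andP[t0 t1] M0 ME xM yM; rewrite boundary_upper_half_space.
set S := image _ _.
have lbM : lbound S M.
  move=> _ [z /= z0 <-]; set u := Num.max _ _.
  have u0 : 0 <= u by rewrite le_max enorm_ge0.
  rewrite -(ler_pXn2r (n := 2)) ?nnegrE // ME.
  (* The square of a maximum dominates every convex combination of the two squares. *)
  apply: (@le_trans _ _ ((1 - t) * enorm (x - z) ^+ 2 + t * enorm (y - z) ^+ 2)).
    rewrite stewart lerD2r; apply: le_trans (lastc_sqr_le _).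
    by rewrite /lastc !mxE [z _ _]z0 subr0.
  have xu : enorm (x - z) ^+ 2 <= u ^+ 2.
    by rewrite ler_pXn2r ?nnegrE ?enorm_ge0 // le_max lexx.
  have yu : enorm (y - z) ^+ 2 <= u ^+ 2.
    by rewrite ler_pXn2r ?nnegrE ?enorm_ge0 // le_max lexx orbT.
  by nra.
set z := proj0 _ in xM yM.
have Sz : S (Num.max (enorm (x - z)) (enorm (y - z))).
  by exists z => //=; exact: lastc_proj0.
apply/eqP; rewrite eq_le; apply/andP; split.
  apply: le_trans (_ : Num.max (enorm (x - z)) (enorm (y - z)) <= M).
    by apply: ge_inf => //; exists M.
  by rewrite ge_max xM yM.
by apply: lb_le_inf => //; eexists; exact: Sz.
Qed.

Lemma tilde_cC (G : set 'rV[R]_m.+1) x y : tilde_c G x y = tilde_c G y x.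
Proof.
rewrite /tilde_c enormB; congr (_ / inf _).
by apply: eq_imagel => z _; rewrite maxC.
Qed.

End HalfSpace.

Theorem theorem3p5 (R : realType) (m : nat) (x y : 'rV[R]_m.+1)
    (hx : upper_half_space R m x) (hy : upper_half_space R m y) :
  tilde_c (upper_half_space R m) x y =
  if enorm (x - y) <= Num.sqrt ((lastc x - lastc y) ^+ 2
                                + `|lastc x ^+ 2 - lastc y ^+ 2|)
  then enorm (x - y) / Num.max (lastc x) (lastc y)
  else 2 * Num.sqrt ((enorm (x - y) ^+ 2 - (lastc x - lastc y) ^+ 2)
                     / (enorm (x - y) ^+ 2 + 4 * lastc x * lastc y)).
Proof.
wlog yx : x y hx hy / lastc y <= lastc x.
  move=> H; have /orP[yx|xy] := le_total (lastc y) (lastc x); first exact: H.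
  rewrite tilde_cC H // enormB maxC -sqrrN opprB distrC.
  by rewrite mulrAC.
rewrite /upper_half_space /= in hx hy.
have dE := enorm_sub_proj0 x y; have d'E := enorm_sub_proj0 y x.
have infE := @inf_max_enorm _ _ x y.
rewrite (max_l yx) ger0_norm; last by rewrite subr_ge0 ler_sqr ?nnegrE ?(ltW hx) ?(ltW hy).
rewrite /tilde_c.
have d0 := enorm_ge0 (x - y).
rewrite (enormB y x) in d'E.
set d := enorm (x - y) in dE d'E infE d0 *.
set a := lastc x in hx yx dE d'E infE *; set b := lastc y in hy yx dE d'E infE *.
(* Exchanging the endpoints replaces [t] by [1 - t], so [d'E] measures the distance from [y] to the
   same projection. *)
have swap t : (1 - t) *: x + t *: y = (1 - (1 - t)) *: y + (1 - t) *: x.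
  by rewrite subKr addrC.
rewrite -[X in X <= _]ger0_norm // -sqrtr_sqr ler_sqrt; last first.
  by rewrite addr_ge0 ?sqr_ge0 // subr_ge0 ler_sqr ?nnegrE ?(ltW hx) ?(ltW hy).
(* At [t = 0] the point is the projection of [x], at distance [a] from [x]; the case hypothesis says
   exactly that [y] is no farther from it. *)
case: leP => [dle|dgt].
  rewrite (infE 0 a) ?lexx ?ler01 ?(ltW hx) //; first by ring.
    rewrite -(ler_pXn2r (n := 2)) ?nnegrE ?enorm_ge0 ?(ltW hx) // dE; lra.
  rewrite -(ler_pXn2r (n := 2)) ?nnegrE ?enorm_ge0 ?(ltW hx) // swap d'E; lra.
(* [h] is the squared horizontal distance between [x] and [y]. *)
set h := d ^+ 2 - (a - b) ^+ 2 in dE *.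
have d'E' t : enorm (y - proj0 ((1 - t) *: y + t *: x)) ^+ 2
    = t ^+ 2 * h + b ^+ 2 by rewrite d'E /h; ring.
have ab : b ^+ 2 <= a ^+ 2 by rewrite ler_sqr ?nnegrE ?(ltW hx) ?(ltW hy).
have hgt : a ^+ 2 - b ^+ 2 < h by rewrite /h; lra.
have h0 : 0 < h by lra.
have hN0 : h != 0 by rewrite gt_eqF.
have d2E : d ^+ 2 = h + (a - b) ^+ 2 by rewrite /h; ring.
have ab0 : 0 < a * b by exact: mulr_gt0.
have D0 : 0 < d ^+ 2 + 4 * a * b by have := sqr_ge0 d; lra.
have d2gt0 : 0 < d ^+ 2 by have := sqr_ge0 (a - b); lra.
have dN0 : d != 0 by apply: contraTneq d2gt0 => ->; rewrite expr0n ltxx.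
(* This [t] solves [t^2 h + a^2 = (1 - t)^2 h + b^2], and [M2] is the common squared distance. It
   lies in [0, 1] because [0 <= a^2 - b^2 < h]. *)
pose t := (h - (a ^+ 2 - b ^+ 2)) / (2 * h).
pose M2 := t ^+ 2 * h + a ^+ 2.
have M20 : 0 <= M2.
  by apply: addr_ge0; [apply: mulr_ge0; [exact: sqr_ge0|exact: ltW]|exact: sqr_ge0].
(* The numerator factors because [d^2 + 4ab = h + (a + b)^2]; hence [d^2 / M2] is the square of the
   claimed value. *)
have M2E : M2 = d ^+ 2 * (d ^+ 2 + 4 * a * b) / (4 * h).
  by rewrite /M2 /t d2E; field.
rewrite (infE t (Num.sqrt M2)) ?sqrtr_ge0 //.
- rewrite -[in LHS](ger0_norm d0) -sqrtr_sqr -sqrtrV // -sqrtrM ?sqr_ge0 //.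
  rewrite -[2 in RHS]ger0_norm // -sqrtr_sqr -sqrtrM ?sqr_ge0 // M2E.
  by congr Num.sqrt; field; rewrite dN0 hN0 gt_eqF.
- apply/andP; split; first by apply: divr_ge0; lra.
  by rewrite ler_pdivrMr; lra.
- by rewrite sqr_sqrtr // /M2 /t d2E; field.
- by rewrite -(ler_pXn2r (n := 2)) ?nnegrE ?enorm_ge0 ?sqrtr_ge0 // dE sqr_sqrtr.
- rewrite -(ler_pXn2r (n := 2)) ?nnegrE ?enorm_ge0 ?sqrtr_ge0 //.
  by rewrite swap d'E' sqr_sqrtr // le_eqVlt; apply/orP; left; apply/eqP; rewrite /M2 /t; field.
Qed.
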